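(* Consider a direct sum of complex vector spaces $\mathfrak{so}(14)_{\mathbb{C}} \oplus V$, where $V$ is a $64$-dimensional complex vector space. Suppose a bracket is defined which gives the usual Lie algebra structure on the subspace $\mathfrak{so}(14)_{\mathbb{C}}$ and is such that the brackets $[X,v]\in V$, for $X \in \mathfrak{so}(14)_{\mathbb{C}}$ and $v \in V$, define an action of $\mathfrak{so}(14)_{\mathbb{C}}$ on $V$ under which $V$ becomes an irreducible $\mathfrak{so}(14)_{\mathbb{C}}$-module. Then the only way to extend this bracket to all of $\mathfrak{so}(14)_{\mathbb{C}} \oplus V$ so as to make it a Lie algebra is to put the abelian structure on $V$, i.e. $[v,v'] = 0$ for all $v,v' \in V$. In particular, the only possible Lie algebra structure of this kind is the semidirect sum of $\mathfrak{so}(14)_{\mathbb{C}}$ with $V$, where $V$ is a $64$-dimensional abelian ideal which is irreducible under the action of $\mathfrak{so}(14)_{\mathbb{C}}$ (so this is the only possible definition of the complexified GraviGUT algebra as a Lie algebra).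
   Context: $\mathfrak{so}(14)_{\mathbb{C}}$ is the complex simple Lie algebra of complex $14\times 14$ matrices $N$ with $N^{\mathrm{tr}}=-N$ (type $D_7$, dimension $91$). It is the complexification of $\mathfrak{spin}(11,3)$. The complexified GraviGUT algebra is meant to be a Lie algebra extension of $\mathfrak{so}(14)_{\mathbb{C}}$, with underlying vector space $\mathfrak{so}(14)_{\mathbb{C}}\oplus V$, where $V$ is a $64$-dimensional irreducible representation of $\mathfrak{so}(14)_{\mathbb{C}}$ and the bracket restricts to the usual one on $\mathfrak{so}(14)_{\mathbb{C}}$ and to the module action between $\mathfrak{so}(14)_{\mathbb{C}}$ and $V$; a priori the bracket of two elements of $V$ may be any element of $\mathfrak{so}(14)_{\mathbb{C}}\oplus V$. *)

(* Defs.v *)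
From HB Require Import structures.
From mathcomp Require Import all_boot all_order all_algebra.
From mathcomp Require Import reals complex.

Set Implicit Arguments.
Unset Strict Implicit.
Unset Printing Implicit Defensive.

Import GRing.Theory.
Local Open Scope ring_scope.

Record lie_bracket (K : fieldType) (L : lmodType K) (br : L -> L -> L) : Prop :=
  LieBracket {
    lie_linearl : forall y, linear (br^~ y);
    lie_linearr : forall x, linear (br x);
    lie_alternating : forall x, br x x = 0;
    lie_jacobi : forall x y z,
      br x (br y z) + br y (br z x) + br z (br x y) = 0
  }.

Record lie_action (K : fieldType) (L M : lmodType K) (br : L -> L -> L)
    (act : L -> M -> M) : Prop :=
  LieAction {
    act_linearl : forall v, linear (act^~ v);
    act_linearr : forall x, linear (act x);
    act_bracket : forall x y v,
      act (br x y) v = act x (act y v) - act y (act x v)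
  }.

Definition irreducible_action (K : fieldType) (L : lmodType K) (V : vectType K)
    (act : L -> V -> V) : Prop :=
  fullv != 0%VS :> {vspace V} /\
  forall W : {vspace V},
    (forall x w, w \in W -> act x w \in W) -> W = 0%VS \/ W = fullv.

Definition lie_ideal (K : fieldType) (L : vectType K) (br : L -> L -> L)
    (U : {vspace L}) : Prop :=
  forall x u, u \in U -> br x u \in U.

Definition lie_abelian (K : fieldType) (L : vectType K) (br : L -> L -> L)
    (U : {vspace L}) : Prop :=
  {in U &, forall u v, br u v = 0}.

(* The kernel of N |-> N^T + N; see skew_mxP. *)
Definition skew_mx (K : fieldType) (n : nat) : {vspace 'M[K]_n} :=
  lker (linfun (@trmx K n n) + \1)%VF.

Lemma skew_mxP (K : fieldType) (n : nat) (N : 'M[K]_n) :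
  reflect (N^T = - N) (N \in skew_mx K n).
Proof.
rewrite memv_ker add_lfunE id_lfunE lfunE /= addr_eq0; exact: eqP.
Qed.

Notation "''so[' K ]_ n" := (subvs_of (skew_mx K n))
  (at level 8, n at level 2, format "''so[' K ]_ n") : type_scope.

Lemma skew_mx_comm (K : fieldType) (n : nat) (X Y : 'so[K]_n) :
  val X *m val Y - val Y *m val X \in skew_mx K n.
Proof.
have /skew_mxP hX := valP X; have /skew_mxP hY := valP Y.
apply/skew_mxP; rewrite linearB /= !trmx_mul hX hY.
by rewrite !mulNmx !mulmxN !opprK opprB.
Qed.

Definition so_bracket (K : fieldType) (n : nat) (X Y : 'so[K]_n) : 'so[K]_n :=
  Subvs (skew_mx_comm X Y).

Section Extension.
Variables (K : fieldType) (n : nat) (V : vectType K).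
Implicit Types (act : 'so[K]_n -> V -> V).
Implicit Types (br : 'so[K]_n * V -> 'so[K]_n * V -> 'so[K]_n * V).

(* br has the prescribed values on so x so and so x V; nothing is imposed
   on V x V. *)
Definition extends_action act br : Prop :=
  (forall X Y, br (X, 0) (Y, 0) = (so_bracket X Y, 0)) /\
  (forall X v, br (X, 0) (0, v) = (0, act X v)).

Definition semidirect_bracket act : 'so[K]_n * V -> 'so[K]_n * V -> 'so[K]_n * V :=
  fun x y => (so_bracket x.1 y.1, act x.1 y.2 - act y.1 x.2).

Definition V_summand : {vspace 'so[K]_n * V} := lker (linfun fst).

Lemma V_summandP (x : 'so[K]_n * V) : reflect (x.1 = 0) (x \in V_summand).
Proof. by rewrite memv_ker lfunE /=; apply: eqP. Qed.

End Extension.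

Arguments V_summand {K n V}.

(* Main.v *)
Require Import Defs.
From HB Require Import structures.
From mathcomp Require Import all_boot all_order all_algebra.
From mathcomp Require Import reals complex.
From mathcomp Require Import boolp spectral ring zify.
Import Order.TTheory GRing.Theory Num.Theory.
Local Open Scope ring_scope.

Set Implicit Arguments.
Unset Strict Implicit.
Unset Printing Implicit Defensive.

(** The bracket of two elements of V is forced to vanish by equivariance, once
the weights of V are known to be half-integral.

In a basis of C^14 made of isotropic vectors in dual pairs, so(14) is spanned by
elements E b c whose indices run over 14 signed coordinates; the elements
h_1, ..., h_7 with dual indices commute, and their joint eigenvalues on V are
the weights.  The other E b c shift a weight by a root +-e_i +-e_j, so by
irreducibility V is spanned by weight vectors whose weights differ from one
weight mu by vectors with integral coordinates and even coordinate sum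
([weight_span_full]).

The sl2 triples attached to the roots show that all mu_i +- mu_j are integers;
hence the coordinates of mu are all integral or all half-integral.  Dimension
64 excludes the integral case ([no_integral_weight]).  If some integral weight
had at least two nonzero coordinates, lowering it would produce a weight with
coordinates in {-1, 0, 1} and d nonzero ones, 2 <= d <= 6; its orbit under
signed permutations has 'C(7, d) * 2 ^ d > 64 elements, and all of them are
weights.  Otherwise every weight is zero or +-e_i.  A vector of weight zero is
killed by every E b c and would span V, so the seven operators h_i ^ 2 are
idempotents with sum 1; they have equal traces, and 7 would divide 64.

Now let v and w have weights mu + k and mu + k'.  By the Jacobi identity the
two components of [v, w] have weight 2 mu + k + k'.  This is integral, so it is
not a weight of V and the component in V vanishes.  The sum of its coordinates
is odd, while the element h_1 + ... + h_7 of so(14) squares to 1 as a matrix,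
so that its adjoint eigenvalues lie in {-2, 0, 2} ([grading_ad]); the component
in so(14) vanishes as well. *)

(** * Eigenvalues and traces of matrices *)

(** Eigenvalues are roots of the characteristic polynomial. *)
Lemma size_eigenvalues (F : fieldType) n (A : 'M[F]_n) (s : seq F) :
    uniq s ->
    (forall a, a \in s -> exists2 v : 'cV[F]_n, v != 0 & A *m v = a *: v) ->
  (size s <= n)%N.
Proof.
move=> us sE; rewrite -ltnS -(size_char_poly A^T).
apply: max_poly_roots us; first by rewrite monic_neq0 ?char_poly_monic.
apply/allP => a /sE[v v0 Av]; rewrite -eigenvalue_root_char.
apply/eigenvalueP; exists v^T; last by rewrite trmx_eq0.
by rewrite -trmx_mul Av linearZ.
Qed.

(** A rank factorisation A = C R of an idempotent satisfies R C = 1, and the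
trace of C R is that of R C. *)
Lemma mxtrace_idempotent (F : fieldType) n (A : 'M[F]_n) :
  A *m A = A -> \tr A = (\rank A)%:R.
Proof.
move=> AA; have := mulmx_base A.
have /row_full_inj := col_base_full A; have /row_free_inj := row_base_free A.
move: (row_base A) (col_base A) => R C Rinj Cinj CR.
rewrite -{1}CR mxtrace_mulC; suff -> : R *m C = 1%:M by rewrite mxtrace1.
apply: Cinj; apply: Rinj.
by rewrite mulmx1 mulmxA CR -mulmxA CR.
Qed.

(** * Triples of type sl2 *)

Section Sl2.
Variables (F : numFieldType) (n : nat).
Implicit Types (e f h x : 'M[F]_n) (v : 'cV[F]_n).

Lemma iter_shift h x c v (j : F) k :
    h *m x - x *m h = c *: x -> h *m v = j *: v ->
  h *m iter k (mulmx x) v = (j + c *+ k) *: iter k (mulmx x) v.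
Proof.
move=> hx hv; elim: k => [|k IHk]; first by rewrite mulr0n addr0.
have hxE : h *m x = c *: x + x *m h by rewrite -hx subrK.
rewrite /= mulmxA hxE mulmxDl -mulmxA IHk -scalemxAl -scalemxAr -scalerDl.
by rewrite mulrS; congr (_ *: _); ring.
Qed.

(** The iterates of x on v have pairwise distinct eigenvalues j + c k under h, so
only finitely many of them are nonzero. *)
Lemma ladder_top h x c v (j : F) :
    c != 0 -> h *m x - x *m h = c *: x -> h *m v = j *: v -> v != 0 ->
  exists k, iter k (mulmx x) v != 0 /\ iter k.+1 (mulmx x) v = 0.
Proof.
move=> c0 hx hv v0.
have iter0 : exists k, iter k (mulmx x) v == 0.
  apply: contrapT => /forallNP nz.
  suff: (n.+1 <= n)%N by rewrite ltnn.
  rewrite -[X in (X <= _)%N](size_iota 0) -(size_map (fun k => j + c *+ k)).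
  apply: (@size_eigenvalues _ _ h).
    rewrite map_inj_uniq ?iota_uniq // => p q /addrI.
    rewrite -[in RHS]mulr_natr -[c *+ p]mulr_natr => /(mulfI c0)/eqP.
    by rewrite eqr_nat => /eqP.
  move=> a /mapP[k _ ->]; exists (iter k (mulmx x) v); last exact: iter_shift.
  by apply/negP; exact: nz.
case: (ex_minnP iter0) => -[|m]; first by rewrite /= (negPf v0).
move=> /eqP im0 mmin; exists m; split=> //.
by apply/negP => /mmin; rewrite ltnn.
Qed.

Variables (e f h : 'M[F]_n).
Hypotheses (he : h *m e - e *m h = 2 *: e) (hf : h *m f - f *m h = (- 2) *: f).
Hypothesis ef : e *m f - f *m e = h.

Lemma raise_lowered v (j : F) k :
    e *m v = 0 -> h *m v = j *: v ->
  e *m iter k.+1 (mulmx f) v = (k.+1%:R * (j - k%:R)) *: iter k (mulmx f) v.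
Proof.
move=> ev hv.
have efE : e *m f = h + f *m e by rewrite -ef subrK.
elim: k => [|k IHk].
  by rewrite /= mulmxA efE mulmxDl -mulmxA ev mulmx0 addr0 hv subr0 mul1r.
rewrite iterS mulmxA efE mulmxDl (iter_shift _ hf hv) -mulmxA IHk -scalemxAr.
by rewrite -[f *m _]iterS -scalerDl -!natr1; congr (_ *: _); ring.
Qed.

(** At the last nonzero iterate f^k v the coefficient (k + 1)(j - k) of
[raise_lowered] has to vanish. *)
Lemma highest_weight_nat v (j : F) :
  e *m v = 0 -> h *m v = j *: v -> v != 0 -> exists k : nat, j = k%:R.
Proof.
move=> ev hv v0.
have [|k [ik ik1]] := ladder_top _ hf hv v0; first by rewrite oppr_eq0 pnatr_eq0.
exists k; apply/eqP; rewrite -subr_eq0.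
have := raise_lowered k ev hv; rewrite ik1 mulmx0 => /esym/eqP.
by rewrite scaler_eq0 (negPf ik) orbF mulf_eq0 pnatr_eq0.
Qed.

(** Raising v as far as possible gives a highest weight vector, whose eigenvalue
j + 2 k is natural. *)
Lemma weight_int v (j : F) :
  h *m v = j *: v -> v != 0 -> exists z : int, j = z%:~R.
Proof.
move=> hv v0.
have [|k [ik ik1]] := ladder_top _ he hv v0; first by rewrite pnatr_eq0.
have [m jm] := highest_weight_nat ik1 (iter_shift k he hv) ik.
exists (m%:Z - 2 * k%:Z); rewrite rmorphB rmorphM /= -!pmulrn -jm.
by rewrite -mulr_natr; ring.
Qed.

End Sl2.

(** A vector killed by e has a natural eigenvalue under h. *)
Lemma raise_negative (F : numFieldType) n (e f h : 'M[F]_n) (v : 'cV[F]_n) (z : int) :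
    h *m e - e *m h = 2 *: e -> h *m f - f *m h = (- 2) *: f ->
    e *m f - f *m e = h -> h *m v = z%:~R *: v -> v != 0 -> (z < 0)%R ->
  e *m v != 0.
Proof.
move=> he hf ef hv v0 z0; apply/negP => /eqP ev.
have [k /eqP] := highest_weight_nat hf ef ev hv v0.
by rewrite pmulrn eqr_int => /eqP zk; move: z0; rewrite zk.
Qed.

(** * Weights of a module over so(2l) *)

Section Weights.
Variables (F : numClosedFieldType) (l n : nat).
Local Notation J := ('I_l * bool)%type.
Implicit Types (b c : J) (v w : 'cV[F]_n) (mu : 'I_l -> F).

(** The index (i, false) stands for the basis vector p_i and (i, true) for its
dual q_i; [opp_ix] exchanges the two. *)
Definition opp_ix (b : J) : J := (b.1, ~~ b.2).

(** The weight of the basis vector b: e_i for p_i and -e_i for q_i. *)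
Definition eps (b : J) (i : 'I_l) : int := if b.1 == i then (-1) ^+ b.2 else 0.
Definition coord (R : zmodType) (m : 'I_l -> R) (b : J) : R :=
  if b.2 then - m b.1 else m b.1.

Lemma opp_ixK : involutive opp_ix.
Proof. by case=> i s; rewrite /opp_ix /= negbK. Qed.
Lemma eq_opp_ix b c : (opp_ix b == opp_ix c) = (b == c).
Proof. exact: inj_eq (inv_inj opp_ixK) _ _. Qed.

(** The commutators of the elements x_b x_c^T - x_c x_b^T of so(2l), for a basis
with x_b^T x_c = 1 if c is dual to b and 0 otherwise. *)
Record so_relations (E : J -> J -> 'M[F]_n) : Prop := SoRelations {
  so_skew : forall b c, E c b = - E b c;
  so_comm : forall a b c d, E a b *m E c d - E c d *m E a b =
    (b == opp_ix c)%:R *: E a d - (b == opp_ix d)%:R *: E a c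
    - (a == opp_ix c)%:R *: E b d + (a == opp_ix d)%:R *: E b c }.

(** Stable subspaces are replaced by arbitrary linear predicates, so that spans of
weight vectors and lines can be used without building them as subspaces. *)
Definition irreducible_mx (E : J -> J -> 'M[F]_n) : Prop :=
  forall P : 'cV[F]_n -> Prop,
    P 0 -> (forall a v w, P v -> P w -> P (a *: v + w)) ->
    (forall b c v, P v -> P (E b c *m v)) ->
  forall v0, v0 != 0 -> P v0 -> forall v, P v.

Variable E : J -> J -> 'M[F]_n.
Hypothesis soE : so_relations E.

Definition cartan i := E (i, false) (i, true).
Definition weight_vec mu v := forall i, cartan i *m v = mu i *: v.

Lemma so_diag b : E b b = 0.
Proof.
apply/eqP; have /eqP := so_skew soE b b; rewrite -addr_eq0 -mulr2n -scaler_nat.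
by rewrite scaler_eq0 pnatr_eq0.
Qed.

Lemma coroot_comm a b c :
  E a (opp_ix a) *m E b c - E b c *m E a (opp_ix a) =
    (((a == b)%:R - (opp_ix a == b)%:R) + ((a == c)%:R - (opp_ix a == c)%:R)) *: E b c.
Proof.
have subst_l x y z : (x == y)%:R *: E x z = (x == y)%:R *: E y z.
  by case: eqP => [->|_] //; rewrite !scale0r.
have oppC x y : (x == opp_ix y) = (opp_ix x == y) by rewrite -[in RHS]eq_opp_ix opp_ixK.
rewrite (so_comm soE) !eq_opp_ix !oppC !subst_l (so_skew soE b c) !scalerN.
rewrite -!scaleNr -!scalerDl.
by congr (_ *: _); ring.
Qed.

Lemma cartan_comm i b c :
  cartan i *m E b c - E b c *m cartan i = (eps b i + eps c i)%:~R *: E b c.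
Proof.
have epsE d : (eps d i)%:~R = ((i, false) == d)%:R - ((i, true) == d)%:R :> F.
  rewrite /eps eq_sym; case: d => x [|]; rewrite !xpair_eqE /= ?andbF ?andbT;
  by case: eqP; rewrite ?subr0 ?sub0r ?subrr.
by rewrite coroot_comm -!epsE -rmorphD.
Qed.

Lemma cartan_coroot b : E b (opp_ix b) = (-1) ^+ b.2 *: cartan b.1.
Proof.
rewrite /cartan; case: b => i [] /=; rewrite ?scale1r //.
by rewrite (so_skew soE) scaleN1r.
Qed.

Lemma coroot_weight mu b v :
  weight_vec mu v -> E b (opp_ix b) *m v = coord mu b *: v.
Proof.
move=> wv; rewrite cartan_coroot -scalemxAl wv scalerA /coord.
by case: b.2; rewrite ?mulN1r ?mul1r.
Qed.

Lemma weight_shift mu b c v : weight_vec mu v ->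
  weight_vec (fun i => mu i + (eps b i + eps c i)%:~R) (E b c *m v).
Proof.
move=> wv i; have := cartan_comm i b c.
move/eqP; rewrite subr_eq => /eqP hE; rewrite mulmxA hE mulmxDl -mulmxA wv.
by rewrite -scalemxAl -scalemxAr -scalerDl addrC.
Qed.

(** For b and c on different coordinates, E b c, E (opp_ix c) (opp_ix b) and the
coroot form an sl2 triple. *)
Section Root.
Variables b c : J.
Hypothesis bc : b.1 != c.1.
Let coroot := E b (opp_ix b) + E c (opp_ix c).

Let neq : ((b == c) = false) * ((c == b) = false)
  * ((opp_ix b == c) = false) * ((c == opp_ix b) = false)
  * ((b == opp_ix c) = false) * ((opp_ix c == b) = false).
Proof.
by do !split; apply/eqP => /(congr1 fst) /= /eqP;
  rewrite ?(negPf bc) // eq_sym (negPf bc).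
Qed.

Let opp_neq x : ((opp_ix x == x) = false) * ((x == opp_ix x) = false).
Proof.
by split; apply/negP => /eqP/(congr1 snd) /=; case: x.2.
Qed.

Lemma root_ef :
  E b c *m E (opp_ix c) (opp_ix b) - E (opp_ix c) (opp_ix b) *m E b c = coroot.
Proof.
rewrite (so_comm soE) !opp_ixK !eqxx !neq.
by rewrite !scale0r !scale1r !subr0.
Qed.

Lemma root_he : coroot *m E b c - E b c *m coroot = 2 *: E b c.
Proof.
rewrite mulmxDl mulmxDr opprD addrACA !coroot_comm ?eq_opp_ix ?eqxx ?opp_neq ?neq.
by rewrite -scalerDl /= ?mulr1n ?mulr0n; congr (_ *: _); ring.
Qed.

Lemma root_hf :
  coroot *m E (opp_ix c) (opp_ix b) - E (opp_ix c) (opp_ix b) *m coroot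
  = (- 2) *: E (opp_ix c) (opp_ix b).
Proof.
rewrite mulmxDl mulmxDr opprD addrACA !coroot_comm ?eq_opp_ix ?eqxx ?opp_neq ?neq.
by rewrite -scalerDl /= ?mulr1n ?mulr0n; congr (_ *: _); ring.
Qed.

Lemma root_weight mu v : weight_vec mu v ->
  coroot *m v = (coord mu b + coord mu c) *: v.
Proof. by move=> wv; rewrite mulmxDl !(coroot_weight _ wv) scalerDl. Qed.

Lemma root_integral mu v : weight_vec mu v -> v != 0 ->
  exists z : int, coord mu b + coord mu c = z%:~R.
Proof.
move=> /root_weight wv; exact: (weight_int root_he root_hf root_ef wv).
Qed.

Lemma root_raise mu v z : weight_vec mu v -> v != 0 ->
  coord mu b + coord mu c = z%:~R -> z < 0 -> E b c *m v != 0.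
Proof.
move=> /root_weight wv v0 zE; rewrite zE in wv.
exact: (raise_negative root_he root_hf root_ef wv v0).
Qed.
End Root.

(** Sums of weight vectors with weights in the coset of mu modulo the root
lattice, which consists of the integral vectors with even coordinate sum. *)
Inductive weight_span mu : 'cV[F]_n -> Prop :=
| WeightSpan0 : weight_span mu 0
| WeightSpanD (k : 'I_l -> int) v w :
    (exists z, \sum_i k i = z * 2) ->
    weight_vec (fun i => mu i + (k i)%:~R) v ->
    weight_span mu w -> weight_span mu (v + w).

Lemma weight_vecZ mu a v : weight_vec mu v -> weight_vec mu (a *: v).
Proof. by move=> wv i; rewrite -scalemxAr wv !scalerA mulrC. Qed.

Lemma sum_eps b : \sum_i eps b i = (-1) ^+ b.2.
Proof.
rewrite (bigD1 b.1) //= /eps eqxx big1 ?addr0 // => i.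
by rewrite eq_sym => /negPf ->.
Qed.

Hypothesis n_gt0 : (0 < n)%N.

Lemma weight_vec_exists : exists2 v, v != 0 & exists mu, weight_vec mu v.
Proof.
have [|v v0 /allP vE] :=
    @common_eigenvector F n [seq (cartan i)^T | i : 'I_l] n_gt0.
  move=> _ _ /mapP[i _ ->] /mapP[j _ ->]; rewrite /comm_mx -!trmx_mul.
  have := cartan_comm i (j, false) (j, true); rewrite /eps /= expr1 expr0.
  case: eqP; rewrite ?addr0 ?subrr scale0r => _ /eqP;
  by rewrite subr_eq0 => /eqP ->.
have {}vE i : exists a, cartan i *m v^T == a *: v^T.
  have /vE/sub_rVP[a va] : (cartan i)^T \in [seq (cartan i)^T | i : 'I_l].
    exact: image_f.
  by exists a; rewrite -linearZ /= -va trmx_mul trmxK.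
exists v^T; first by rewrite trmx_eq0.
by exists (fun i => xchoose (vE i)) => i; apply/eqP/(xchooseP (vE i)).
Qed.

Hypothesis irrE : irreducible_mx E.

(** The span contains v0 and is stable, because E b c changes the coordinate sum of
a weight by -2, 0 or 2. *)
Lemma weight_span_full mu v0 v :
  weight_vec mu v0 -> v0 != 0 -> weight_span mu v.
Proof.
move=> wv0 v00; apply: (irrE (P := weight_span mu)) v00 _ v.
- exact: WeightSpan0.
- move=> a u w + sw; elim=> [|k x y kE wx _ IH]; first by rewrite scaler0 add0r.
  by rewrite scalerDr -addrA; by apply: (WeightSpanD kE) IH; apply: weight_vecZ.
- move=> b c u; elim=> [|k x y [z kE] wx _ IH]; first by rewrite mulmx0; constructor.
  rewrite mulmxDr; apply: (@WeightSpanD _ (fun i => k i + (eps b i + eps c i))) IH.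
    rewrite !big_split /= kE !sum_eps.
    by case: b.2; case: c.2; [exists (z - 1) | exists z | exists z | exists (z + 1)];
      rewrite ?expr1 ?expr0; ring.
  by move=> i; rewrite (weight_shift _ _ wx) -addrA -rmorphD.
- rewrite -[v0]addr0; apply: (@WeightSpanD _ (fun=> 0)).
  + by exists 0; rewrite big1 ?mul0r.
  + by move=> i; rewrite wv0 addr0.
  + exact: WeightSpan0.
Qed.

Lemma weight_span_ext mu v0 (A : 'M[F]_n) :
    weight_vec mu v0 -> v0 != 0 ->
    (forall (k : 'I_l -> int) v,
      weight_vec (fun i => mu i + (k i)%:~R) v -> A *m v = 0) ->
  A = 0.
Proof.
move=> wv0 v00 A0; have {}A0 v : A *m v = 0.
  elim: (weight_span_full v wv0 v00) => [|k u w _ wu _ IH]; first by rewrite mulmx0.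
  by rewrite mulmxDr (A0 _ _ wu) IH addr0.
by apply/matrixP => i j; have /matrixP/(_ i 0) := A0 (delta_mx j 0); rewrite -colE !mxE.
Qed.
End Weights.

(** * Small integral weights *)

Definition support_size l (k : 'I_l -> int) := #|[set i | k i != 0]|.

(** Vectors with coordinates in {-1, 0, 1} are encoded by finite functions with
values in [option bool], to be able to count them. *)
Definition signval (o : option bool) : int := if o is Some s then (-1) ^+ s else 0.

(** The orbit of (1, ..., 1, 0, ..., 0), with d ones, under signed permutations. *)
Definition orbit_of l d : {set {ffun 'I_l -> option bool}} :=
  [set f : {ffun 'I_l -> option bool} | #|[set i | f i != None]| == d].

(** Choose the support, then a sign at each of its points. *)
Lemma card_orbit_of l d : #|orbit_of l d| = ('C(l, d) * 2 ^ d)%N.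
Proof.
rewrite -sum1_card (partition_big
  (fun f : {ffun 'I_l -> option bool} => [set i | f i != None])
  (fun D : {set 'I_l} => #|D| == d)) => [|f]; last by rewrite inE.
rewrite -[X in 'C(X, d)](card_ord l) -card_draws -sum1dep_card big_distrl /=.
apply: eq_bigr => D /eqP cD; rewrite mul1n sum1dep_card.
have -> : 2%N = #|predC1 (None : option bool)| by rewrite cardC1 card_option card_bool.
rewrite -cD -(card_pffun_on None); apply: eq_card => f.
rewrite !inE; apply/andP/pffun_onP => [[_ /eqP <-]|[fD fR]].
  split; first by apply/subsetP => i; rewrite !inE.
  by move=> _ /imageP[i + ->]; rewrite !inE.
suff -> : [set i | f i != None] = D by rewrite cD !eqxx.
apply/setP => i; rewrite inE; apply/idP/idP => [fi|iD].
  by apply: (subsetP fD); rewrite inE.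
by have /fR := image_f f iD; rewrite !inE.
Qed.

(** Uniqueness of balanced ternary expansions: the digits are read off modulo 3. *)
Lemma balanced_ternary_inj l (x y : 'I_l -> int) :
    (forall i, `|x i| <= 1) -> (forall i, `|y i| <= 1) ->
    \sum_(i < l) 3 ^+ i * x i = \sum_(i < l) 3 ^+ i * y i ->
  x =1 y.
Proof.
elim: l x y => [|l IH] x y x1 y1; first by move=> _ [].
rewrite !big_ord_recl /= !mul1r.
have e (w : 'I_l.+1 -> int) : \sum_(i < l) 3 ^+ bump 0 i * w (lift ord0 i) =
    3 * \sum_(i < l) 3 ^+ i * w (lift ord0 i).
  by rewrite mulr_sumr; apply: eq_bigr => i _; rewrite /bump add1n exprS mulrA.
rewrite !e => xy.
have [xy0 xyS] : x ord0 = y ord0 /\ \sum_(i < l) 3 ^+ i * x (lift ord0 i) =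
    \sum_(i < l) 3 ^+ i * y (lift ord0 i).
  by have := x1 ord0; have := y1 ord0; move: xy; lia.
have /(_ _ _ xyS) {}IH := IH (fun i => x (lift ord0 i)) (fun i => y (lift ord0 i)).
move=> i; case: (unliftP ord0 i) => [j ->|->//]; exact: IH.
Qed.

Section Integral.
Variables (F : numClosedFieldType) (l n : nat).
Variable E : 'I_l * bool -> 'I_l * bool -> 'M[F]_n.
Hypothesis soE : so_relations E.
Implicit Types k g : 'I_l -> int.

Definition is_weight k : Prop :=
  exists2 v, v != 0 & weight_vec E (fun i => (k i)%:~R) v.

Lemma is_weight_ext k g : k =1 g -> is_weight k -> is_weight g.
Proof. by move=> /funext ->. Qed.

(** Subtracting a root that pairs positively with a weight gives a weight.  The
root is s e_i + t e_j, with signs given as booleans. *)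
Lemma is_weight_step k i j (s t : bool) :
    i != j -> is_weight k -> 0 < (-1) ^+ s * k i + (-1) ^+ t * k j ->
  is_weight (fun x => k x - (if x == i then (-1) ^+ s
                             else if x == j then (-1) ^+ t else 0)).
Proof.
move=> ij [v v0 wv] pos.
exists (E (i, ~~ s) (j, ~~ t) *m v).
  have cE (x : 'I_l) (u : bool) : coord (fun x => (k x)%:~R) (x, ~~ u) =
      (- ((-1) ^+ u * k x))%:~R :> F.
    by rewrite /coord; case: u; rewrite /= ?mulN1r ?mul1r ?opprK ?rmorphN.
  apply: (root_raise soE (b := (i, ~~ s)) (c := (j, ~~ t)) ij wv v0).
    by rewrite !cE -rmorphD.
  by rewrite -opprD oppr_lt0.
move=> x; rewrite (weight_shift soE _ _ wv) -rmorphD /=.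
congr (_ %:~R *: _); congr (_ + _); rewrite /eps /= ![_ == x]eq_sym.
case: (eqVneq x i) => [->|_]; rewrite ?(negPf ij) ?addr0 ?add0r.
  by case: (s).
by case: eqP; case: (t); rewrite ?oppr0.
Qed.

(** For k j = 0 and u = +-1 this moves a nonzero coordinate from i to j. *)
Definition relocate k i j (u : int) : 'I_l -> int :=
  fun x => if x == i then 0 else if x == j then u else k x.

Lemma is_weight_relocate k i j u :
    i != j -> `|k i| = 1 -> k j = 0 -> `|u| = 1 ->
  is_weight k -> is_weight (relocate k i j u).
Proof.
move=> ij ki kj u1 /(@is_weight_step _ _ _ (k i == -1) (u == 1) ij).
rewrite kj mulr0 addr0 => H; apply: is_weight_ext (H _).
  move=> x; rewrite /relocate; case: (eqVneq x i) => [->|_].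
    by case: eqP ki; rewrite ?expr1 ?expr0; lia.
  case: (eqVneq x j) => [->|_]; last by rewrite subr0.
  by rewrite kj; case: eqP u1; rewrite ?expr1 ?expr0; lia.
by case: eqP ki; rewrite ?expr1 ?expr0; lia.
Qed.

Lemma support_relocate k i j u : i != j -> u != 0 ->
  k i != 0 -> k j = 0 -> support_size (relocate k i j u) = support_size k.
Proof.
move=> ij u0 ki kj; rewrite /support_size.
have -> : [set x | relocate k i j u x != 0] = j |: ([set x | k x != 0] :\ i).
  apply/setP => x; rewrite !inE /relocate.
  case: (eqVneq x i) => [->|_]; first by rewrite eqxx (negPf ij).
  by case: (eqVneq x j) => //=; rewrite u0.
rewrite cardsU1 !inE kj eqxx andbF /=.
by rewrite [in RHS](cardsD1 i) inE ki.
Qed.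

Lemma sign_mul_norm (x : int) : (-1) ^+ (x < 0)%R * x = `|x|.
Proof. by case: ltP => x0; rewrite ?expr1 ?expr0; lia. Qed.

Lemma absz_sub_sign (x : int) : x != 0 -> `|(x - (-1) ^+ (x < 0)%R)%R|%N = `|x|%N.-1.
Proof. by case: ltP => x0 nz; rewrite ?expr1 ?expr0; lia. Qed.

(** The support of k is moved point by point onto that of g; a wrong sign is then
corrected by moving the coordinate to a free place and back, which is why one
coordinate of k has to be zero. *)
Lemma is_weight_orbit k g :
    (forall i, `|k i| <= 1) -> (forall i, `|g i| <= 1) ->
    support_size k = support_size g -> (support_size k < l)%N ->
  is_weight k -> is_weight g.
Proof.
have [d] := ubnP #|[set i | k i != g i]|; elim: d k => // d IH k; rewrite ltnS.
move=> kd k1 g1 kg kl wk.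
have [<- //|kgn] := EM (k = g).
have {kgn} [i ki] : exists i, k i != g i.
  apply: contrapT => /forallNP H; apply: kgn; apply/funext => x.
  exact/eqP/negPn/negP/H.
have [supp_eq|] := eqVneq [set x | k x != 0] [set x | g x != 0].
  have supp x : (k x == 0) = (g x == 0).
    by have /setP/(_ x) := supp_eq; rewrite !inE => /(congr1 negb); rewrite !negbK.
  have [j kj] : exists j, k j == 0.
    apply: contrapT => /forallNP H; move: kl; rewrite /support_size.
    have -> : [set x | k x != 0] = [set: 'I_l].
      by apply/setP => x; rewrite !inE; apply/negP/H.
    by rewrite cardsT card_ord ltnn.
  have ki0 : k i != 0.
    by apply: contraNneq ki => e; rewrite e eq_sym -supp e.
  have gi0 : g i != 0 by rewrite -supp.
  have ij : i != j by apply: contraNneq ki0 => ->.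
  have ki1 : `|k i| = 1 by have := k1 i; move: ki0; lia.
  have gi1 : `|g i| = 1 by have := g1 i; move: gi0; lia.
  (* The supports agree and the signs at i differ: go through the free place j. *)
  have w1 := is_weight_relocate ij ki1 (eqP kj) (u := 1) erefl wk.
  have ji : j != i by rewrite eq_sym.
  have rj : relocate k i j 1 j = 1 by rewrite /relocate eqxx (negPf ji).
  have ri : relocate k i j 1 i = 0 by rewrite /relocate eqxx.
  have w2 := is_weight_relocate ji (congr1 _ rj) ri gi1 w1.
  have e x : relocate (relocate k i j 1) j i (g i) x = if x == i then g i else k x.
    rewrite /relocate; case: (eqVneq x j) => [->|_]; last by case: eqP.
    by rewrite (negPf ji) (eqP kj).
  apply: (IH _ _ _ g1 _ _ (is_weight_ext e w2)).
  - apply: leq_trans kd; rewrite [X in (_ < X)%N](cardsD1 i) inE ki ltnS.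
    apply/subset_leq_card/subsetP => x; rewrite !inE.
    by case: (eqVneq x i) => [->|] //; rewrite eqxx.
  - by move=> x; case: eqP.
  - rewrite -kg /support_size; congr #|pred_of_set _|; apply/setP => x; rewrite !inE.
    by case: (eqVneq x i) => [->|] //; rewrite gi0 ki0.
  - apply: leq_trans kl; rewrite ltnS.
    apply/subset_leq_card/subsetP => x; rewrite !inE.
    by case: (eqVneq x i) => [->|] //; rewrite ?gi0 ?ki0.
move=> supp_ne.
have card_le : (#|[set x | g x != 0]| <= #|[set x | k x != 0]|)%N.
  by rewrite -[X in (_ <= X)%N]/(support_size k) kg.
have /subsetPn[a] : ~~ ([set x | k x != 0] \subset [set x | g x != 0]).
  apply: (contra _ supp_ne) => sub; rewrite eqEcard sub; exact: card_le.
rewrite !inE negbK => ka /eqP ga.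
have /subsetPn[b] : ~~ ([set x | g x != 0] \subset [set x | k x != 0]).
  apply: (contra _ supp_ne) => sub; rewrite eq_sym eqEcard sub.
  by move: kg; rewrite /support_size => ->; exact: leqnn.
rewrite !inE negbK => gb /eqP kb.
have ab : a != b by apply: contraNneq ka => ->; apply/eqP.
have ka1 : `|k a| = 1 by have := k1 a; move: ka; lia.
have gb1 : `|g b| = 1 by have := g1 b; move: gb; lia.
have w1 := is_weight_relocate ab ka1 kb gb1 wk.
apply: (IH _ _ _ g1 _ _ w1).
- apply: leq_trans kd; rewrite [X in (_ < X)%N](cardsD1 a) inE ga ka ltnS.
  apply/subset_leq_card/subsetP => x; rewrite !inE /relocate.
  case: (eqVneq x a) => [->|_]; first by rewrite ga eqxx.
  by case: (eqVneq x b) => [->|//]; rewrite eqxx.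
- by move=> x; rewrite /relocate; case: eqP => // _; case: eqP.
- by rewrite support_relocate.
- by rewrite support_relocate.
Qed.

(** The combination of the h_i with coefficients 3 ^ i separates the weights with
coordinates in {-1, 0, 1}, so it has one eigenvalue for each element of the
orbit. *)
Lemma size_weight_orbit k :
    (forall i, `|k i| <= 1) -> (support_size k < l)%N -> is_weight k ->
  ('C(l, support_size k) * 2 ^ support_size k <= n)%N.
Proof.
move=> k1 kl wk; rewrite -card_orbit_of cardE.
pose z (f : {ffun 'I_l -> option bool}) : int := \sum_(i < l) 3 ^+ i * signval (f i).
have sv1 o : `|signval o| <= 1 by case: o => [[]|].
have sv_inj : injective signval by case=> [[]|] [[]|].
rewrite -(size_map (fun f => (z f)%:~R : F)).
apply: (@size_eigenvalues _ _ (\sum_(i < l) 3 ^+ i *: cartan E i)).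
  rewrite map_inj_in_uniq ?enum_uniq // => f g _ _ /intr_inj fg.
  apply/ffunP => i; apply: sv_inj; move: i.
  exact: balanced_ternary_inj fg.
move=> _ /mapP[f + ->]; rewrite mem_enum inE => /eqP ff.
have [||v v0 wv] := @is_weight_orbit k (signval \o f) k1 _ _ kl wk; first by move=> i /=.
  rewrite -ff; congr #|pred_of_set _|; apply/setP => i; rewrite !inE /=.
  by case: (f i) => [[]|].
exists v => //; rewrite mulmx_suml rmorph_sum scaler_suml; apply: eq_bigr => i _.
by rewrite -scalemxAl wv scalerA rmorphM rmorphXn.
Qed.

(** Induction on the squared length.  If no coordinate vanishes, two of them are
moved towards zero, and at least two others stay nonzero.  If some coordinate
vanishes and another exceeds 1 in absolute value, one unit is transferred from
the latter to the former.  Both moves shorten the weight and keep two nonzero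
coordinates; when neither applies, the weight has the required form. *)
Lemma is_weight_descend k : (3 < l)%N -> is_weight k -> (1 < support_size k)%N ->
  exists g, [/\ is_weight g, forall i, `|g i| <= 1, (1 < support_size g)%N
              & (support_size g < l)%N].
Proof.
move=> l4.
have [d] := ubnP (\sum_i `|k i| ^ 2)%N; elim: d k => // d IH k; rewrite ltnS.
move=> kd wk k2.
have norm_lt g i j : i != j -> (forall x, x != i -> x != j -> g x = k x) ->
    (`|g i| ^ 2 + `|g j| ^ 2 < `|k i| ^ 2 + `|k j| ^ 2)%N ->
    (\sum_i `|g i| ^ 2 < d)%N.
  move=> ij gk lt; apply: leq_trans kd.
  rewrite (bigD1 i) // (bigD1 j) 1?eq_sym //= [X in (_ < X)%N](bigD1 i) //.
  rewrite [X in (_ < _ + X)%N](bigD1 j) 1?eq_sym //= !addnA.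
  rewrite (eq_bigr (fun x => `|k x| ^ 2)%N) ?ltn_add2r // => x /andP[xi xj].
  by rewrite gk.
have [all0|/existsNP[j /negP/negPn/eqP kj]] := EM (forall i, k i != 0).
  pose i := Ordinal (ltn_trans (isT : 0 < 3)%N l4).
  pose j := Ordinal (ltn_trans (isT : 1 < 3)%N l4).
  pose p := Ordinal (ltn_trans (isT : 2 < 3)%N l4).
  pose q := Ordinal l4.
  have ij : i != j by [].
  pose g x := k x - (if x == i then (-1) ^+ (k i < 0)%R
                     else if x == j then (-1) ^+ (k j < 0)%R else 0).
  have [kj ki] := (all0 j, all0 i).
  have wg : is_weight g.
    apply: is_weight_step => //; rewrite !sign_mul_norm.
    by move: ki kj; clear; lia.
  apply: (IH g _ wg).
    apply: (norm_lt _ _ _ ij).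
      by move=> x /negPf xi /negPf xj; rewrite /g xi xj subr0.
    rewrite /g eqxx eq_sym (negPf ij) eqxx !absz_sub_sign //.
    by move: ki kj; clear; case: (k i) => [[|?]|?]; case: (k j) => [[|?]|?]; nia.
  apply/card_gt1P; exists p, q; split=> //; rewrite inE /g /= subr0; exact: all0.
have [small|/existsNP[i /negP ki]] := EM (forall i, `|k i| <= 1).
  exists k; split=> //; rewrite /support_size -[X in (_ < X)%N]card_ord.
  rewrite -cardsT proper_card // properEneq subsetT andbT.
  by apply/negP => /eqP/setP/(_ j); rewrite !inE kj eqxx.
have ij : i != j by apply: contraNneq ki => ->; rewrite kj.
pose g x := k x - (if x == i then (-1) ^+ (k i < 0)%R
                   else if x == j then (-1) ^+ true else 0).
have wg : is_weight g.
  apply: is_weight_step => //; rewrite sign_mul_norm kj mulr0 addr0.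
  by move: ki; clear; lia.
apply: (IH g _ wg).
  apply: (norm_lt _ _ _ ij).
    by move=> x /negPf xi /negPf xj; rewrite /g xi xj subr0.
  have ki0 : k i != 0 by move: ki; clear; lia.
  rewrite /g eqxx eq_sym (negPf ij) eqxx absz_sub_sign // kj.
  have -> : `|(0 - (-1) ^+ true)%R : int|%N = 1%N by [].
  by move: ki; clear; case: (k i) => [[|[|?]]|[|?]]; nia.
have ki0 : k i != 0 by move: ki; clear; lia.
have gi0 : g i != 0.
  by rewrite /g eqxx -absz_eq0 absz_sub_sign //; move: ki; clear; lia.
have gj0 : g j != 0 by rewrite /g [j == i]eq_sym (negPf ij) eqxx kj.
by apply/card_gt1P; exists i, j; rewrite !inE.
Qed.
End Integral.

(** * Irreducible modules of dimension 64 over so(14) *)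

Section Dim64.
Variables (F : numClosedFieldType) (n : nat).
Variable E : 'I_7 * bool -> 'I_7 * bool -> 'M[F]_n.
Hypotheses (soE : so_relations E) (irrE : irreducible_mx E) (n64 : n = 64%N).
Implicit Types k g : 'I_7 -> int.

(** For 2 <= d <= 6 the number 'C(7, d) * 2 ^ d is at least 84. *)
Lemma support_weight_le1 g : is_weight E g -> (support_size g <= 1)%N.
Proof.
move=> wg; rewrite leqNgt; apply/negP => g2.
have [k [wk k1 k2 k7]] := is_weight_descend soE isT wg g2.
have := size_weight_orbit soE k1 k7 wk; rewrite n64.
by case: (support_size k) k2 k7 => [|[|[|[|[|[|[|?]]]]]]].
Qed.

Lemma two_support g i j : i != j -> g i != 0 -> g j != 0 -> (1 < support_size g)%N.
Proof. by move=> ij gi gj; apply/card_gt1P; exists i, j; rewrite !inE. Qed.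

Lemma exists_neq (i : 'I_7) : exists j, i != j.
Proof.
by exists (if i == ord0 then ord_max else ord0); case: (eqVneq i ord0) => [->|].
Qed.

(** Otherwise subtracting a root would give a weight with two nonzero
coordinates. *)
Lemma small_weight g i : is_weight E g -> `|g i| <= 1.
Proof.
move=> wg; rewrite leNgt; apply/negP => gi.
have [j ij] := exists_neq i.
have gj : g j = 0.
  apply/eqP; apply: contraT => gj.
  have := support_weight_le1 wg; rewrite leqNgt (two_support ij _ gj) //.
  by move: gi; clear; lia.
pose g' x := g x - (if x == i then (-1) ^+ (g i < 0)%R
                    else if x == j then (-1) ^+ true else 0).
have wg' : is_weight E g'.
  apply: is_weight_step => //; rewrite sign_mul_norm gj mulr0 addr0.
  by move: gi; clear; lia.
have := support_weight_le1 wg'; rewrite leqNgt (two_support ij) //.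
  by rewrite /g' eqxx -absz_eq0 absz_sub_sign; move: gi; clear; lia.
by rewrite /g' [j == i]eq_sym (negPf ij) eqxx gj.
Qed.

(** A vector of weight zero is killed by the h_i, and the weights of its other
images under E b c would have two nonzero coordinates; so all images vanish and
the vector spans a stable line. *)
Lemma zero_not_weight : ~ is_weight E (fun=> 0).
Proof.
case=> v v0 wv.
have E0 b c : E b c *m v = 0.
  have [bc|bc] := eqVneq b.1 c.1.
    have [<-|bc'] := eqVneq b c; first by rewrite so_diag // mul0mx.
    have -> : c = opp_ix b.
      by case: b c bc bc' => x [] [y []] /= ->; rewrite /opp_ix /= ?eqxx.
    by rewrite (coroot_weight soE _ wv) /coord oppr0 if_same scale0r.
  apply/eqP; apply: contraT => Ev.
  have : is_weight E (fun i => eps b i + eps c i).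
    by exists (E b c *m v) => // i; rewrite (weight_shift soE _ _ wv) add0r.
  move/support_weight_le1; rewrite leqNgt (two_support bc) // /eps eqxx.
    by rewrite [c.1 == _]eq_sym (negPf bc) addr0 signr_eq0.
  by rewrite (negPf bc) add0r signr_eq0.
have line u : exists a, u = a *: v.
  apply: (irrE (P := fun u => exists a, u = a *: v)) v0 _ u.
  - by exists 0; rewrite scale0r.
  - by move=> a _ _ [x ->] [y ->]; exists (a * x + y); rewrite scalerDl scalerA.
  - by move=> b c _ [x ->]; exists 0; rewrite -scalemxAr E0 scaler0 scale0r.
  - by exists 1; rewrite scale1r.
have n1 : (1 < n)%N by rewrite n64.
(* Two distinct unit vectors cannot both be multiples of v. *)
pose i0 := Ordinal (ltnW n1); pose i1 := Ordinal n1.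
have [a /matrixP da] := line (delta_mx i0 0); have [b /matrixP db] := line (delta_mx i1 0).
have := da i0 0; have := da i1 0; have := db i1 0; rewrite !mxE !eqxx /=.
move=> bv /esym/eqP; rewrite mulf_eq0 => /orP[/eqP->|/eqP v1].
  by rewrite mul0r => /eqP; rewrite oner_eq0.
by move: bv; rewrite v1 mulr0 => /eqP; rewrite oner_eq0.
Qed.

Lemma weight_sum_sqr g : is_weight E g -> \sum_i g i ^+ 2 = 1.
Proof.
move=> wg; have [i gi] : exists i, g i != 0.
  apply: contrapT => /forallNP g0; apply: zero_not_weight.
  by apply: is_weight_ext wg => i; apply/eqP/negPn/negP/g0.
rewrite (bigD1 i) //= big1 ?addr0 => [|j ji].
  by have := small_weight i wg; move: gi; clear; nia.
apply/eqP; rewrite sqrf_eq0; apply: contraT => gj.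
by have := support_weight_le1 wg; rewrite leqNgt (two_support ji gj gi).
Qed.

(** The coroot h_i - h_j is a commutator [e, f], where e commutes with h_i + h_j.
Hence (h_i - h_j) (h_i + h_j) = h_i ^ 2 - h_j ^ 2 has trace zero. *)
Lemma cartan_trace i j :
  \tr (cartan E i *m cartan E i) = \tr (cartan E j *m cartan E j).
Proof.
have [->//|ij] := eqVneq i j.
set b : 'I_7 * bool := (i, false); set c : 'I_7 * bool := (j, true).
have := root_ef soE (b := b) (c := c) ij.
set e := E b c; set f := E (opp_ix c) (opp_ix b).
rewrite !(cartan_coroot soE) /= expr1 expr0 scale1r scaleN1r.
set hi := cartan E i; set hj := cartan E j => efE.
have hij : hi *m hj = hj *m hi.
  apply/eqP; rewrite -subr_eq0 (cartan_comm soE) /eps /=.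
  by rewrite [j == i]eq_sym (negPf ij) addr0 scale0r.
have es : (hi + hj) *m e = e *m (hi + hj).
  apply/eqP; rewrite -subr_eq0 mulmxDl mulmxDr opprD addrACA !(cartan_comm soE).
  rewrite -scalerDl -rmorphD /eps /= !eqxx [j == i]eq_sym (negPf ij) expr1 expr0.
  by rewrite addr0 add0r subrr scale0r.
apply/eqP; rewrite -subr_eq0 -raddfB /=.
have -> : hi *m hi - hj *m hj = (hi - hj) *m (hi + hj).
  by rewrite mulmxBl !mulmxDr hij opprD addrA addrK.
rewrite -efE mulmxBl raddfB /= [X in X - _]mxtrace_mulC -[f *m e *m _]mulmxA -es.
by rewrite [X in _ - X]mxtrace_mulC !mulmxA subrr.
Qed.

(** The h_i ^ 2 are idempotents with sum 1 and equal traces, that is, equal ranks r;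
then 7 r = 64. *)
Lemma no_integral_weight k : ~ is_weight E k.
Proof.
case=> v0 v00 wv0.
have n_gt0 : (0 < n)%N by rewrite n64.
have ext (A : 'M[F]_n) :
    (forall g v, v != 0 -> weight_vec E (fun i => (g i)%:~R) v -> A *m v = 0) -> A = 0.
  move=> A0; apply: (weight_span_ext soE irrE wv0 v00) => g v wv.
  have [->|vn0] := eqVneq v 0; first by rewrite mulmx0.
  by apply: (A0 (fun i => k i + g i)) => // i; rewrite wv rmorphD.
have sum1 : \sum_i cartan E i *m cartan E i = 1%:M.
  apply/eqP; rewrite -subr_eq0; apply/eqP; apply: ext => g v vn0 wv.
  have wg : is_weight E g by exists v.
  rewrite mulmxBl mulmx_suml mul1mx.
  rewrite (eq_bigr (fun i => (g i ^+ 2)%:~R *: v)) => [|i _].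
    by rewrite -scaler_suml -rmorph_sum (weight_sum_sqr wg) scale1r subrr.
  by rewrite -mulmxA wv -scalemxAr wv scalerA -rmorphM.
have idem i : (cartan E i *m cartan E i) *m (cartan E i *m cartan E i)
    = cartan E i *m cartan E i.
  apply/eqP; rewrite -subr_eq0; apply/eqP; apply: ext => g v vn0 wv.
  have wg : is_weight E g by exists v.
  rewrite mulmxBl -!mulmxA !(wv, =^~ scalemxAr) !scalerA -scalerBl -!rmorphM -rmorphB /=.
  suff -> : g i * g i * g i * g i - g i * g i = 0 by rewrite scale0r.
  have gi : g i = -1 \/ g i = 0 \/ g i = 1.
    by have := small_weight i wg; clear; lia.
  by case: gi => [|[]] ->; ring.
have := congr1 mxtrace sum1; rewrite mxtrace1 raddf_sum /=.
rewrite (eq_bigr (fun=> (\rank (cartan E ord0 *m cartan E ord0))%:R)) => [|i _].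
  rewrite sumr_const card_ord -[LHS]mulr_natr -natrM => /eqP; rewrite eqr_nat => /eqP.
  by move: (\rank _) => r; lia.
by rewrite (cartan_trace i ord0) mxtrace_idempotent.
Qed.

(** The sums and differences of two coordinates are pairings with coroots, hence
integers.  One integral coordinate would therefore make all of them integral. *)
Lemma weights_half_integral mu v :
    weight_vec E mu v -> v != 0 ->
  forall i, exists z : int, 2 * mu i = (2 * z + 1)%:~R.
Proof.
move=> wv v0.
have pairs i j (s : bool) : i != j -> exists z : int, mu i + (-1) ^+ s * mu j = z%:~R.
  move=> ij; have [z] := root_integral soE (b := (i, false)) (c := (j, s)) ij wv v0.
  by rewrite /coord /= => zE; exists z; rewrite -zE; case: (s); rewrite ?expr1 ?mulN1r ?mul1r.
have n_gt0 : (0 < n)%N by rewrite n64.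
have [j0 j0E] := exists_neq ord0.
have int2 i : exists z : int, 2 * mu i = z%:~R.
  have [j ij] := exists_neq i.
  have [[x xE] [y yE]] := (pairs i j false ij, pairs i j true ij).
  by exists (x + y); rewrite rmorphD /= -xE -yE expr0 expr1; ring.
have [[z z0] | odd0] := EM (exists z : int, mu ord0 = z%:~R).
  have allint i : exists z : int, mu i = z%:~R.
    have [<-|] := eqVneq ord0 i; first by exists z.
    move=> /pairs-/(_ false)[x]; rewrite expr0 mul1r z0 => xE.
    by exists (x - z); rewrite rmorphB /= -xE addrC addKr.
  have [k kE] := choice allint.
  by case: (@no_integral_weight k); exists v => // i; rewrite wv kE.
(* An even 2 * mu_0 would make mu_0 integral. *)
have half0 : exists z : int, 2 * mu ord0 = (2 * z + 1)%:~R.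
  have [z zE] := int2 ord0; exists (z %/ 2)%Z; rewrite zE; congr _%:~R.
  have [zmod|zmod] : (z = (z %/ 2)%Z * 2 \/ z = 2 * (z %/ 2)%Z + 1) by lia.
    case: odd0; exists (z %/ 2)%Z; apply: (mulfI (_ : 2 != 0)); first by rewrite pnatr_eq0.
    by rewrite zE [in LHS]zmod rmorphM /= mulrC.
  by [].
move=> i; have [<-|] := eqVneq ord0 i; first by [].
move=> /pairs-/(_ false)[x]; rewrite expr0 mul1r => xE.
have [z zE] := half0; exists (x - z - 1).
have -> : 2 * mu i = 2 * x%:~R - 2 * mu ord0 by rewrite -xE; ring.
by rewrite zE !(rmorphD, rmorphB, rmorphM, rmorphN) /=; ring.
Qed.
End Dim64.

(** * A split basis of so(2l) *)

Section Isotropic.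
Variables (F : numClosedFieldType) (l : nat).
Local Notation J := ('I_l * bool)%type.
Implicit Types b c : J.

(** The dual pairs are p_i = e_i + 'i e_(l+i) and q_i = (e_i - 'i e_(l+i)) / 2; the
asymmetric scaling avoids square roots of 2. *)
Definition isotropic b : 'cV[F]_(l + l) :=
  (if b.2 then 2^-1 else 1) *:
  col_mx (delta_mx b.1 0) ((if b.2 then - 'i else 'i) *: delta_mx b.1 0).

Lemma isotropic_dot b c : (isotropic b)^T *m isotropic c = (b == opp_ix c)%:R%:M.
Proof.
rewrite /isotropic !linearZ /= tr_col_mx linearZ /= !trmx_delta.
rewrite -!(scalemxAl, scalemxAr) mul_row_col -!(scalemxAl, scalemxAr).
rewrite !mul_delta_mx_cond -!scaler_nat; set d := delta_mx _ _.
have -> : d = 1%:M by apply/matrixP => x y; rewrite !ord1 !mxE.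
rewrite -!(scalemx1 _ _%:R) !scale_scalar_mx -raddfD /= !scale_scalar_mx mulr1.
congr _%:M; have i2 : 'i * 'i = -1 :> F by rewrite -expr2 sqrCi.
case: b c => i [] [j []]; rewrite /opp_ix xpair_eqE /= ?andbF ?andbT;
  case: (i == j); rewrite /= ?mulr0n ?mulr1n; by field: i2.
Qed.

Lemma isotropic_dyad i :
  isotropic (i, false) *m (isotropic (i, true))^T =
    2^-1 *: block_mx (delta_mx i i) (- 'i *: delta_mx i i)
                     ('i *: delta_mx i i) (delta_mx i i).
Proof.
rewrite /isotropic /= scale1r linearZ /= -scalemxAr tr_col_mx linearZ /= !trmx_delta.
rewrite mul_col_row -!(scalemxAl, scalemxAr) !mul_delta_mx scalerA mulrN -expr2 sqrCi.
by rewrite opprK scale1r.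
Qed.

Lemma isotropic_dyadT i :
  isotropic (i, true) *m (isotropic (i, false))^T =
    2^-1 *: block_mx (delta_mx i i) ('i *: delta_mx i i)
                     (- 'i *: delta_mx i i) (delta_mx i i).
Proof.
rewrite -[LHS]trmxK trmx_mul trmxK isotropic_dyad linearZ /= tr_block_mx.
by rewrite !linearZ /= !trmx_delta.
Qed.

Lemma isotropic_complete :
  \sum_b isotropic b *m (isotropic (opp_ix b))^T = 1%:M.
Proof.
pose D (A : 'M[F]_l) : 'M[F]_(l + l) := block_mx A 0 0 A.
have D0 : D 0 = 0 by rewrite /D block_mx_const.
have DD : {morph D : A B / A + B} by move=> A B; rewrite /D add_block_mx !addr0.
rewrite -(pair_big xpredT xpredT
  (fun i s => isotropic (i, s) *m (isotropic (opp_ix (i, s)))^T)) /=.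
rewrite (eq_bigr (fun i => D (delta_mx i i))) => [|i _].
  rewrite -(big_morph D DD D0) -mx1_sum_delta /D.
  by rewrite -scalar_mx_block.
rewrite big_bool /opp_ix /= isotropic_dyad isotropic_dyadT -scalerDr add_block_mx.
rewrite !scaleNr subrr addNr -!mulr2n -!scaler_nat scale_block_mx !scaler0.
by rewrite !scalerA mulVf ?scale1r ?pnatr_eq0.
Qed.

Lemma wedge_skew (x y : 'cV[F]_(l + l)) : x *m y^T - y *m x^T \in skew_mx F (l + l).
Proof. by apply/skew_mxP; rewrite linearB /= !trmx_mul !trmxK opprB. Qed.

Definition so_elt b c : 'so[F]_(l + l) := Subvs (wedge_skew (isotropic b) (isotropic c)).

Lemma so_elt_skew b c : so_elt c b = - so_elt b c.
Proof. by apply: val_inj; rewrite linearN /= opprB. Qed.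

Lemma so_elt_comm a b c d : so_bracket (so_elt a b) (so_elt c d) =
  (b == opp_ix c)%:R *: so_elt a d - (b == opp_ix d)%:R *: so_elt a c
  - (a == opp_ix c)%:R *: so_elt b d + (a == opp_ix d)%:R *: so_elt b c.
Proof.
apply: val_inj; rewrite linearD !linearB !linearZ /=.
have dyads (x y z t : J) :
    (isotropic x *m (isotropic y)^T) *m (isotropic z *m (isotropic t)^T)
    = (y == opp_ix z)%:R *: (isotropic x *m (isotropic t)^T).
  by rewrite mulmxA -[_ *m isotropic z]mulmxA isotropic_dot mul_mx_scalar scalemxAl.
have oppC (x y : J) : (x == opp_ix y) = (y == opp_ix x).
  by apply/eqP/eqP => ->; rewrite opp_ixK.
rewrite !(mulmxBl, mulmxBr) !dyads !(oppC d) !(oppC c).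
move: (_ *m (isotropic d)^T) (_ *m (isotropic c)^T) (isotropic b *m (isotropic d)^T)
  (isotropic b *m (isotropic c)^T) (isotropic c *m (isotropic b)^T)
  (isotropic c *m (isotropic a)^T) (isotropic d *m (isotropic b)^T)
  (isotropic d *m (isotropic a)^T) => m1 m2 m3 m4 m5 m6 m7 m8.
by apply/matrixP => x y; rewrite !mxE; ring.
Qed.

(** Inserting the completeness relation on both sides of Y gives
Y = sum y_bc x_b x_c^T; averaging this with Y = - Y^T turns the dyads into
elements of the basis. *)
Lemma so_elt_span (P : 'so[F]_(l + l) -> Prop) :
    P 0 -> (forall a x y, P x -> P y -> P (a *: x + y)) ->
    (forall b c, P (so_elt b c)) ->
  forall x, P x.
Proof.
move=> P0 PD Pelt x; set Y := val x.
have /skew_mxP Yskew : Y \in skew_mx F (l + l) := valP x.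
pose y b c := ((isotropic (opp_ix b))^T *m Y *m isotropic (opp_ix c)) 0 0.
have YE : Y = \sum_b \sum_c y b c *: (isotropic b *m (isotropic c)^T).
  rewrite -[LHS]mul1mx -[LHS]mulmx1 -isotropic_complete mulmx_suml mulmx_suml.
  apply: eq_bigr => b _; rewrite (reindex_inj (inv_inj (@opp_ixK l))) mulmx_sumr.
  apply: eq_bigr => c _; rewrite opp_ixK !mulmxA -[_ *m _ *m Y]mulmxA.
  rewrite -[_ *m _ *m isotropic _]mulmxA.
  by rewrite [X in _ *m X *m _ = _]mx11_scalar mul_mx_scalar -scalemxAl.
have xE : x = 2^-1 *: \sum_b \sum_c y b c *: so_elt b c.
  apply: val_inj; rewrite linearZ linear_sum /=.
  rewrite (eq_bigr (fun b => \sum_c y b c *: (isotropic b *m (isotropic c)^T)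
      - \sum_c y b c *: (isotropic c *m (isotropic b)^T))) => [|b _]; last first.
    rewrite linear_sum -sumrB; apply: eq_bigr => c _.
    by rewrite linearZ /= scalerBr.
  rewrite sumrB -YE.
  have -> : \sum_b \sum_c y b c *: (isotropic c *m (isotropic b)^T) = Y^T.
    rewrite [in RHS]YE linear_sum; apply: eq_bigr => b _; rewrite linear_sum.
    by apply: eq_bigr => c _; rewrite [RHS]linearZ /= trmx_mul trmxK.
  by rewrite Yskew opprK -mulr2n -scaler_nat scalerA mulVf ?scale1r ?pnatr_eq0.
have PZ a z : P z -> P (a *: z) by move=> Pz; rewrite -[_ *: _]addr0; exact: PD.
have PA z t : P z -> P t -> P (z + t) by move=> Pz; rewrite -[z]scale1r; exact: PD.
rewrite xE; apply: (PZ); apply: big_ind => // b _; apply: big_ind => // c _; exact: PZ.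
Qed.

Definition grading_elt : 'so[F]_(l + l) := \sum_i so_elt (i, false) (i, true).

(** This element is 1 on the span of the p_i and -1 on the span of the q_i. *)
Lemma grading_sqr : val grading_elt *m val grading_elt = 1%:M.
Proof.
pose D (A : 'M[F]_l) : 'M[F]_(l + l) := block_mx 0 (- 'i *: A) ('i *: A) 0.
have D0 : D 0 = 0 by rewrite /D !scaler0 block_mx_const.
have DD : {morph D : A B / A + B}.
  by move=> A B; rewrite /D add_block_mx !addr0 !scalerDr.
have -> : val grading_elt = D 1%:M.
  rewrite /grading_elt linear_sum mx1_sum_delta (big_morph D DD D0).
  apply: eq_bigr => i _; rewrite /= isotropic_dyad isotropic_dyadT -scalerBr.
  rewrite opp_block_mx add_block_mx !subrr -!scalerBl.
  rewrite scale_block_mx !scaler0 !scalerA /D.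
  by congr block_mx; congr (_ *: _); field.
rewrite /D mulmx_block !mul0mx !mulmx0 !addr0 !add0r -!scalemxAl -!scalemxAr !mul1mx.
by rewrite !scalerA mulrN mulNr -expr2 sqrCi opprK scale1r -scalar_mx_block.
Qed.

(** With X ^ 2 = 1 one gets [X, [X, [X, Y]]] = 4 [X, Y] for every Y. *)
Lemma grading_ad (nu : F) (y : 'so[F]_(l + l)) :
  so_bracket grading_elt y = nu *: y -> nu ^+ 3 *: y = (4 * nu) *: y.
Proof.
move=> /(congr1 val); rewrite linearZ /=.
have := grading_sqr; set X := \val grading_elt; set Y := \val y => XX XY.
(* In terms of XY and YX the relation nu Y = XY - YX is solved by multiplying it
   by X on either side. *)
have lX : Y - X *m Y *m X = nu *: (X *m Y).
  by rewrite scalemxAr -XY mulmxBr !mulmxA XX mul1mx.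
have rX : X *m Y *m X - Y = nu *: (Y *m X).
  by rewrite scalemxAl -XY mulmxBl -[Y *m X *m X]mulmxA XX mulmx1.
have anti : nu *: (X *m Y) = - (nu *: (Y *m X)) by rewrite -lX -rX opprB.
have YX : nu *: (X *m Y *m X) = - (nu *: Y).
  by rewrite scalemxAl anti mulNmx -scalemxAl -mulmxA XX mulmx1.
have twice : (2 * nu) *: Y = nu ^+ 2 *: (X *m Y).
  by rewrite expr2 -[RHS]scalerA -lX scalerBr YX opprK -scalerDl; congr (_ *: _); ring.
apply: val_inj; rewrite !linearZ /= -/Y.
have -> : nu ^+ 3 *: Y = nu ^+ 2 *: (X *m Y) - nu *: (nu *: (Y *m X)).
  by rewrite scalerA -expr2 -scalerBr XY scalerA -exprSr.
rewrite -[nu *: (nu *: (Y *m X))]opprK -scalerN -anti opprK scalerA -expr2 -twice -scalerDl.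
by congr (_ *: _); ring.
Qed.
End Isotropic.

(** * From an action on V to matrices *)

(** Grow a subspace inside P as long as some vector of P is outside. *)
Lemma vspace_of_pred (F : fieldType) (V : vectType F) (P : V -> Prop) :
    P 0 -> (forall a u v, P u -> P v -> P (a *: u + v)) ->
  exists W : {vspace V}, forall v, v \in W <-> P v.
Proof.
move=> P0 PD.
suff grow d (W : {vspace V}) : (forall w, w \in W -> P w) ->
    (\dim {:V} - \dim W <= d)%N -> exists U : {vspace V}, forall v, v \in U <-> P v.
  by apply: (grow _ 0%VS) (leqnn _) => w; rewrite memv0 => /eqP->.
have maximal (U0 : {vspace V}) : (forall w, w \in U0 -> P w) ->
    ~ (exists v, P v /\ v \notin U0) ->
    exists U : {vspace V}, forall v, v \in U <-> P v.
  move=> U0P noext; exists U0 => v; split; first exact: U0P.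
  by move=> Pv; apply: contrapT => /negP vW; apply: noext; exists v.
elim: d W => [|d IH] W WP dW;
  have [[v [Pv vW]]|] := EM (exists v, P v /\ v \notin W); try exact: maximal.
- have WV : W = fullv by apply/eqP; rewrite eqEdim subvf -subn_eq0 -leqn0.
  by rewrite WV memvf in vW.
- apply: (IH (<[v]> + W)%VS) => [w /memv_addP[_ /vlineP[a ->] [u /WP Pu ->]]|].
    exact: PD.
  rewrite -ltnS; apply: leq_trans dW; apply: ltn_sub2l.
    rewrite ltn_neqAle dimvS ?subvf // andbT; apply: contra vW => /eqP e.
    have -> : W = fullv by apply/eqP; rewrite eqEdim subvf e leqnn.
    exact: memvf.
  rewrite ltn_neqAle dimvS ?addvSr // andbT; apply: contra vW => /eqP e.
  have -> : W = (<[v]> + W)%VS by apply/eqP; rewrite eqEdim addvSr e leqnn.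
  by apply: (subvP (addvSl _ _)); exact: memv_line.
Qed.

Lemma irreducible_pred (F : fieldType) (L : lmodType F) (V : vectType F)
    (act : L -> V -> V) (P : V -> Prop) (v0 : V) :
    irreducible_action act ->
    P 0 -> (forall a u v, P u -> P v -> P (a *: u + v)) ->
    (forall x v, P v -> P (act x v)) -> v0 != 0 -> P v0 ->
  forall v, P v.
Proof.
move=> [_ irr] P0 PD Pact v00 Pv0 v.
have [W WP] := vspace_of_pred P0 PD.
have [|W0|WV] := irr W.
- by move=> x w /WP /(Pact x) /WP.
- by case/negP: v00; rewrite -memv0 -W0; apply/WP.
- by apply/WP; rewrite WV memvf.
Qed.

Import VectorInternalTheory.
Section Operators.
Variables (F : fieldType) (V : vectType F).
Local Notation n := (dim V).

(** Column coordinates, so that operators act by left multiplication and compose in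
the same order as their matrices. *)
Definition coords (v : V) : 'cV[F]_n := (v2r v)^T.
Definition of_coords (x : 'cV[F]_n) : V := r2v x^T.

Lemma coordsK : cancel coords of_coords.
Proof. by move=> v; rewrite /of_coords trmxK v2rK. Qed.
Lemma of_coordsK : cancel of_coords coords.
Proof. by move=> x; rewrite /coords r2vK trmxK. Qed.
Lemma coordsP a u v : coords (a *: u + v) = a *: coords u + coords v.
Proof. by rewrite /coords !linearP. Qed.
Lemma of_coordsP a x y : of_coords (a *: x + y) = a *: of_coords x + of_coords y.
Proof. by rewrite /of_coords !linearP. Qed.

Lemma coords_additive : {morph coords : u v / u + v}.
Proof. by move=> u v; have := coordsP 1 u v; rewrite !scale1r. Qed.
Lemma coords0 : coords 0 = 0.
Proof. by have := coordsP (-1) (0 : V) 0; rewrite scaler0 addr0 scaleN1r addNr. Qed.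
Lemma coordsZ a (v : V) : coords (a *: v) = a *: coords v.
Proof. by have := coordsP a v 0; rewrite coords0 !addr0. Qed.
Lemma coordsN (v : V) : coords (- v) = - coords v.
Proof. by rewrite -scaleN1r coordsZ scaleN1r. Qed.

Definition operator_mx (f : V -> V) : 'M[F]_n :=
  (lin1_mx (fun r => v2r (f (r2v r))))^T.

Lemma operator_mxE f v : linear f -> coords (f v) = operator_mx f *m coords v.
Proof.
move=> lf; pose g r := v2r (f (r2v r)).
have lg : linear g by move=> a x y; rewrite /g !linearP lf linearP.
pose gL : {linear 'rV[F]_n -> 'rV[F]_n} :=
  HB.pack g (GRing.isLinear.Build F 'rV[F]_n 'rV[F]_n *:%R g lg).
rewrite /coords /operator_mx -trmx_mul; congr trmx.
by rewrite -[lin1_mx _]/(lin1_mx gL) mul_rV_lin1 /= /g v2rK.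
Qed.
End Operators.

Section LieAction.
Variables (K : fieldType) (L M : lmodType K).
Variables (lbr : L -> L -> L) (act : L -> M -> M).
Hypothesis actP : lie_action lbr act.

Lemma actD x y v : act (x + y) v = act x v + act y v.
Proof. by have := act_linearl actP v 1 x y; rewrite !scale1r. Qed.
Lemma act0 v : act 0 v = 0.
Proof. by have := actD 0 0 v; rewrite addr0 -[LHS]addr0 => /addrI. Qed.
Lemma actZ a x v : act (a *: x) v = a *: act x v.
Proof. by have := act_linearl actP v a x 0; rewrite act0 !addr0. Qed.
Lemma actN x v : act (- x) v = - act x v.
Proof. by rewrite -scaleN1r actZ scaleN1r. Qed.
Lemma act_sum (I : finType) (x : I -> L) v :
  act (\sum_i x i) v = \sum_i act (x i) v.
Proof. exact: (big_morph (act^~ v) (fun x y => actD x y v) (act0 v)). Qed.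
Lemma actBr x v w : act x (v - w) = act x v - act x w.
Proof. by rewrite -[- w]scaleN1r addrC (act_linearr actP) scaleN1r addrC. Qed.
Lemma actr0 x : act x 0 = 0.
Proof. by have := actBr x 0 0; rewrite !subrr. Qed.
End LieAction.

Section Action.
Variables (F : numClosedFieldType) (l : nat) (V : vectType F).
Variable act : 'so[F]_(l + l) -> V -> V.
Hypothesis actP : lie_action (@so_bracket F (l + l)) act.

Definition action_mx (b c : 'I_l * bool) : 'M[F]_(dim V) :=
  operator_mx (act (so_elt F b c)).

Lemma action_mxE b c v : coords (act (so_elt F b c) v) = action_mx b c *m coords v.
Proof. exact/operator_mxE/(act_linearr actP). Qed.

Lemma action_mx_inj (A B : 'M[F]_(dim V)) :
  (forall v : V, A *m coords v = B *m coords v) -> A = B.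
Proof.
move=> AB; apply/matrixP => i j.
have /matrixP/(_ i 0) := AB (of_coords (delta_mx j 0)).
by rewrite of_coordsK -!colE !mxE.
Qed.

Lemma action_so_relations : so_relations action_mx.
Proof.
split=> [b c|a b c d]; apply: action_mx_inj => v.
  by rewrite mulNmx -!action_mxE so_elt_skew (actN actP) coordsN.
rewrite mulmxBl -!mulmxA -!action_mxE -coordsN -coords_additive -(act_bracket actP).
rewrite so_elt_comm !(actD actP, actN actP, actZ actP) !(coords_additive, coordsN, coordsZ).
by rewrite !action_mxE !(mulmxDl, mulNmx, scalemxAl).
Qed.

Hypothesis irr : irreducible_action act.

Lemma action_irreducible_mx : irreducible_mx action_mx.
Proof.
move=> P P0 PD PE x0 x00 Px0 x; rewrite -[x]of_coordsK.
apply: (irreducible_pred (P := fun v => P (coords v)) (v0 := of_coords x0) irr).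
- by rewrite coords0.
- by move=> a u v Pu Pv; rewrite coordsP; exact: PD.
- move=> y; elim/so_elt_span: y => [v _|a y z Py Pz v Pv|b c v Pv].
  + by rewrite (act0 actP) coords0.
  + by rewrite (actD actP) (actZ actP) coordsP; apply: PD; [exact: Py | exact: Pz].
  + by rewrite action_mxE; exact: PE.
- by apply: contraNneq x00 => e; rewrite -[x0]of_coordsK e coords0.
- by rewrite of_coordsK.
Qed.

End Action.

(** * Lie brackets on the sum of so(2l) and V *)

Section LieBracket.
Variables (K : fieldType) (L : lmodType K) (br : L -> L -> L).
Hypothesis lieP : lie_bracket br.

Lemma brDl x y z : br (x + y) z = br x z + br y z.
Proof. by have := lie_linearl lieP z 1 x y; rewrite !scale1r. Qed.
Lemma brDr z x y : br z (x + y) = br z x + br z y.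
Proof. by have := lie_linearr lieP z 1 x y; rewrite !scale1r. Qed.
Lemma br0l z : br 0 z = 0.
Proof. by have := brDl 0 0 z; rewrite addr0 -[LHS]addr0 => /addrI. Qed.
Lemma br0r z : br z 0 = 0.
Proof. by have := brDr z 0 0; rewrite addr0 -[LHS]addr0 => /addrI. Qed.
Lemma brZr z a x : br z (a *: x) = a *: br z x.
Proof. by have := lie_linearr lieP z a x 0; rewrite br0r !addr0. Qed.
Lemma brNr z x : br z (- x) = - br z x.
Proof. by rewrite -scaleN1r brZr scaleN1r. Qed.
Lemma lie_skew x y : br y x = - br x y.
Proof.
apply/eqP; rewrite -addr_eq0; have := lie_alternating lieP (x + y).
by rewrite brDl !brDr !(lie_alternating lieP) addr0 add0r addrC => ->.
Qed.

End LieBracket.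

Section Extension.
Variables (F : numClosedFieldType) (l : nat) (V : vectType F).
Variable act : 'so[F]_(l + l) -> V -> V.
Hypothesis actP : lie_action (@so_bracket F (l + l)) act.
Local Notation L := ('so[F]_(l + l) * V)%type.
Variable br : L -> L -> L.
Hypotheses (ext : extends_action act br) (lieP : lie_bracket br).

Lemma pair_add (x y : L) : x + y = (x.1 + y.1, x.2 + y.2).
Proof. by []. Qed.

Lemma pair_split (x : L) : x = (x.1, 0) + (0, x.2).
Proof. by case: x => y u; rewrite pair_add /= addr0 add0r. Qed.

Lemma br_so (X : 'so[F]_(l + l)) (x : L) :
  br (X, 0) x = (so_bracket X x.1, act X x.2).
Proof.
case: ext => e1 e2.
by rewrite {1}[x]pair_split (brDr lieP) e1 e2 pair_add /= addr0 add0r.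
Qed.

(** The Jacobi identity: X acts as a derivation. *)
Lemma br_eigen (X : 'so[F]_(l + l)) (v w : V) (p q : F) :
    act X v = p *: v -> act X w = q *: w ->
  so_bracket X (br (0, v) (0, w)).1 = (p + q) *: (br (0, v) (0, w)).1 /\
  act X (br (0, v) (0, w)).2 = (p + q) *: (br (0, v) (0, w)).2.
Proof.
move=> Xv Xw; have := lie_jacobi lieP (X, 0) (0, v) (0, w).
have pair_scale a (x : L) : a *: x = (a *: x.1, a *: x.2) by [].
have Z a (u : V) : ((0, a *: u) : L) = a *: (0, u) by rewrite pair_scale /= scaler0.
rewrite [br (0, w) (X, 0)](lie_skew lieP) !(proj2 ext) Xv Xw !Z.
rewrite (brNr lieP) !(brZr lieP) [br (0, w) (0, v)](lie_skew lieP) scalerN.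
move/eqP; rewrite -addrA -opprD subr_eq0 -scalerDl br_so [q + p]addrC.
rewrite pair_scale => /eqP e.
by split; [exact: (congr1 fst e) | exact: (congr1 snd e)].
Qed.

Lemma abelian_semidirect :
  (forall v w, br (0, v) (0, w) = 0) -> br =2 semidirect_bracket act.
Proof.
move=> ab x y; rewrite {1}[x]pair_split (brDl lieP) br_so.
rewrite {3}[y]pair_split (brDr lieP) ab addr0 (lie_skew lieP) (proj2 ext).
by rewrite pair_add /= subr0.
Qed.
End Extension.

Section Transfer.
Variables (F : numClosedFieldType) (V : vectType F).
Variable act : 'so[F]_(7 + 7) -> V -> V.
Hypothesis dimV : \dim {:V} = 64%N.
Hypothesis actP : lie_action (@so_bracket F (7 + 7)) act.
Hypothesis irr : irreducible_action act.
Variable br : 'so[F]_(7 + 7) * V -> 'so[F]_(7 + 7) * V -> 'so[F]_(7 + 7) * V.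
Hypotheses (ext : extends_action act br) (lieP : lie_bracket br).

Let E := action_mx act.
Let soE : so_relations E := action_so_relations actP.
Let irrE : irreducible_mx E := action_irreducible_mx actP irr.
Let n64 : dim V = 64%N. Proof. by rewrite -dimvf. Qed.

Lemma weight_act mu (v : V) i : weight_vec E mu (coords v) ->
  act (so_elt F (i, false) (i, true)) v = mu i *: v.
Proof.
move=> /(_ i) wv; apply: (can_inj (@coordsK F V)).
by rewrite coordsZ (action_mxE actP).
Qed.

Lemma grading_act mu (v : V) : weight_vec E mu (coords v) ->
  act (grading_elt F 7) v = (\sum_i mu i) *: v.
Proof.
move=> wv; rewrite /grading_elt (act_sum actP) scaler_suml.
by apply: eq_bigr => i _; exact: weight_act.
Qed.

(** A component of [v, w] in V would be a nonzero vector of weight 2 mu + k + k',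
which is integral.  A component in so(14) would be an eigenvector of the grading
element with an odd eigenvalue, whereas [grading_ad] leaves only -2, 0 and 2. *)
Lemma coset_bracket0 mu (z : 'I_7 -> int) (k k' : 'I_7 -> int) (v w : V) :
    (forall i, 2 * mu i = (2 * z i + 1)%:~R) ->
    (exists s, \sum_i k i = s * 2) -> (exists s, \sum_i k' i = s * 2) ->
    weight_vec E (fun i => mu i + (k i)%:~R) (coords v) ->
    weight_vec E (fun i => mu i + (k' i)%:~R) (coords w) ->
  br (0, v) (0, w) = 0.
Proof.
move=> muE [s kE] [s' kE'] wv ww.
set y := (br (0, v) (0, w)).1; set u := (br (0, v) (0, w)).2.
pose m i : int := 2 * z i + 1 + k i + k' i.
have mE i : (mu i + (k i)%:~R) + (mu i + (k' i)%:~R) = (m i)%:~R.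
  by rewrite addrACA -mulr2n -mulr_natl muE /m !rmorphD /= !addrA.
have u0 : u = 0.
  apply/eqP; apply: contraT => u0.
  have wu : weight_vec E (fun i => (m i)%:~R) (coords u).
    move=> i; rewrite -(action_mxE actP) -coordsZ; congr coords.
    rewrite -mE.
    exact: (proj2 (br_eigen ext lieP (weight_act i wv) (weight_act i ww))).
  have cu0 : coords u != 0.
    apply: contraNneq u0 => e.
    by rewrite -[u]coordsK e -(coords0 V) coordsK.
  have [x] := weights_half_integral soE irrE n64 wu cu0 ord0.
  rewrite -[2]/(2%:~R) -rmorphM => /intr_inj; lia.
have y0 : y = 0.
  have [ad _] := br_eigen ext lieP (grading_act wv) (grading_act ww).
  move: ad; rewrite -big_split /= (eq_bigr _ (fun i _ => mE i)) -rmorph_sum /=.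
  set d := \sum_i m i => /grading_ad/eqP; rewrite -subr_eq0 -scalerBl scaler_eq0.
  case/orP => [|/eqP //]; rewrite -rmorphXn -[4]/(4%:~R) -rmorphM -rmorphB intr_eq0.
  (* Each half-integral mu_i enters twice, so d is a sum of 7 odd numbers plus
     even terms. *)
  have -> : d = 2 * (\sum_i z i + s + s' + 3) + 1.
    rewrite /d /m !big_split /= kE kE' -mulr_sumr sumr_const card_ord; ring.
  by move: (_ + 3) => t; clear; nia.
by rewrite [LHS]surjective_pairing -/y -/u y0 u0.
Qed.

(** Both arguments are sums of weight vectors in one coset of the root lattice. *)
Lemma bracket_abelian v w : br (0, v) (0, w) = 0.
Proof.
have n_gt0 : (0 < dim V)%N by rewrite n64.
have [x x0 [mu wx]] := weight_vec_exists soE n_gt0.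
have [z zE] := choice (weights_half_integral soE irrE n64 wx x0).
rewrite -[v]coordsK -[w]coordsK.
have addE a b : (0, of_coords (a + b)) = (0, of_coords a) + (0, of_coords b)
    :> 'so[F]_(7 + 7) * V.
  by rewrite pair_add /= addr0; congr pair; have := of_coordsP 1 a b; rewrite !scale1r.
have c0 : (0, of_coords 0) = 0 :> 'so[F]_(7 + 7) * V.
  by rewrite -(coords0 V) coordsK.
elim: (weight_span_full soE irrE (coords v) wx x0) => [|k a b kE wa _ IHa].
  by rewrite c0 (br0l lieP).
rewrite addE (brDl lieP) IHa addr0.
elim: (weight_span_full soE irrE (coords w) wx x0) => [|k' c d k'E wc _ IHc].
  by rewrite c0 (br0r lieP).
rewrite addE (brDr lieP) IHc addr0.
by apply: (coset_bracket0 zE kE k'E); rewrite of_coordsK.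
Qed.
End Transfer.

Section Semidirect.
Variables (K : fieldType) (n : nat) (V : vectType K) (act : 'so[K]_n -> V -> V).
Hypothesis actP : lie_action (@so_bracket K n) act.

Lemma so_lie : lie_bracket (@so_bracket K n).
Proof.
split.
- move=> y a u v; apply: val_inj; rewrite linearP /=.
  by rewrite mulmxDl mulmxDr -scalemxAl -scalemxAr scalerBr opprD addrACA.
- move=> x a u v; apply: val_inj; rewrite linearP /=.
  by rewrite mulmxDl mulmxDr -scalemxAl -scalemxAr scalerBr opprD addrACA.
- by move=> x; apply: val_inj; rewrite /= subrr.
- move=> x y z; apply: val_inj; rewrite !linearD /=.
  move: (vsval x) (vsval y) (vsval z) => X Y Z.
  rewrite !(mulmxBl, mulmxBr) !mulmxA.
  move: (X *m Y *m Z) (X *m Z *m Y) (Y *m X *m Z) (Y *m Z *m X) (Z *m X *m Y)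
    (Z *m Y *m X) => a b c d e f.
  by apply/matrixP => i j; rewrite !mxE; ring.
Qed.

Lemma semidirect_lie : lie_bracket (semidirect_bracket act).
Proof.
have sl y := lie_linearl so_lie y; have sr x := lie_linearr so_lie x.
have al v a x y : act (a *: x + y) v = a *: act x v + act y v.
  exact: (act_linearl actP).
have ar x := act_linearr actP x.
have lin_pair a (p q : 'so[K]_n * V) :
    a *: p + q = (a *: p.1 + q.1, a *: p.2 + q.2) by [].
split.
- move=> [Y w] a [X u] [Z v]; rewrite /semidirect_bracket !lin_pair /=.
  congr pair; first exact: sl.
  by rewrite /= al ar scalerBr opprD addrACA.
- move=> [Y w] a [X u] [Z v]; rewrite /semidirect_bracket !lin_pair /=.
  congr pair; first exact: sr.
  by rewrite /= al ar scalerBr opprD addrACA.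
- move=> [X u]; rewrite /semidirect_bracket /= subrr; congr pair.
  exact: (lie_alternating so_lie).
- move=> [X u] [Y v] [Z w]; rewrite /semidirect_bracket /=; congr pair.
    exact: (lie_jacobi so_lie).
  rewrite !(actBr actP) !(act_bracket actP).
  move: (act X (act Y w)) (act X (act Z v)) (act Y (act Z u)) (act Z (act Y u))
    (act Y (act X w)) (act Z (act X v)) => a b c d e f.
  change (a - b - (c - d) + (c - e - (f - b)) + (f - d - (a - e)) = 0 :> V).
  apply: (can_inj (@coordsK K V)); rewrite coords0.
  by rewrite !(coords_additive, coordsN); apply/matrixP => i j; rewrite !mxE; ring.
Qed.

Lemma semidirect_extends : extends_action act (semidirect_bracket act).
Proof.
split=> [X Y|X v]; rewrite /semidirect_bracket /=.
  by rewrite !(actr0 actP) subr0.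
rewrite (act0 actP) subr0; congr pair.
by apply: val_inj; rewrite /= mulmx0 mul0mx subrr.
Qed.
End Semidirect.

Theorem theorem2 (R : realType) (V : vectType R[i])
    (act : 'so[R[i]]_14 -> V -> V)
    (dimV : \dim {:V} = 64%N)
    (actP : lie_action (@so_bracket R[i] 14) act)
    (act_irr : irreducible_action act) :
  [/\ forall br : 'so[R[i]]_14 * V -> 'so[R[i]]_14 * V -> 'so[R[i]]_14 * V,
        extends_action act br -> lie_bracket br ->
        forall v v' : V, br (0, v) (0, v') = 0,
      forall br : 'so[R[i]]_14 * V -> 'so[R[i]]_14 * V -> 'so[R[i]]_14 * V,
        (extends_action act br /\ lie_bracket br) <->
        br =2 semidirect_bracket act,
      lie_ideal (semidirect_bracket act) V_summand
    & lie_abelian (semidirect_bracket act) V_summand].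
Proof.
have abelian br : extends_action act br -> lie_bracket br ->
    forall v v' : V, br (0, v) (0, v') = 0.
  move=> ext lieP.
  exact: (@bracket_abelian R[i] V act dimV actP act_irr br ext lieP).
have ext0 := semidirect_extends actP.
split=> // [br|x u /V_summandP u0|u v /V_summandP u0 /V_summandP v0].
- split=> [[ext lieP] x y|brE]; last first.
    have -> : br = semidirect_bracket act.
      by apply/funext => x; apply/funext => y; exact: brE.
    by split; [|exact: semidirect_lie].
  exact: (@abelian_semidirect R[i] 7 V act br ext lieP (abelian br ext lieP)).
- apply/V_summandP; rewrite /semidirect_bracket /= u0.
  by apply: val_inj; rewrite /= mulmx0 mul0mx subrr.
- rewrite /semidirect_bracket u0 v0 !(act0 actP) subrr; congr pair.
  by apply: val_inj; rewrite /= mulmx0 subrr.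
Qed.
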